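(* Let $\Phi\in H^2_{M_n}$ be such that $\Phi^*$ is of bounded type, and write $$\Phi=\Theta A^*\quad(\text{right coprime}).$$ Then, for every Blaschke factor $\theta$, $$\Phi\circ\theta=(\Theta\circ\theta)(A\circ\theta)^*\quad(\text{right coprime}).$$
   Context: $H^2_{M_n}$, $H^\infty_{M_n}$: $n\times n$ matrix functions with entries in the Hardy spaces $H^2,H^\infty$ of the unit disk $\mathbb D$; factorizations are identities a.e. on the unit circle $\mathbb T$. A matrix function is of bounded type if each entry equals a.e. on $\mathbb T$ a quotient of two $H^\infty$ functions. $\Theta\in H^\infty_{M_{n\times m}}$ is inner if $\Theta^*\Theta=I_m$ a.e. on $\mathbb T$. An inner $\Delta\in H^\infty_{M_{n\times m}}$ is a left inner divisor of $F\in H^2_{M_n}$ if $F=\Delta G$ with $G\in H^2_{M_{m\times n}}$; two functions are left coprime if their only common left inner divisors are unitary constants; $F,G$ are right coprime if $\widetilde F,\widetilde G$ are left coprime, where $\widetilde F(z)=F(\overline z)^*$. ''$\Phi=\Theta A^*$ (right coprime)'' means $\Theta\in H^\infty_{M_n}$ is inner, $A\in H^2_{M_n}$, and $\Theta,A$ are right coprime. A Blaschke factor is $b_\alpha(z)=\frac{z-\alpha}{1-\overline\alpha z}$ with $\alpha\in\mathbb D$. *)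

(* Defs.v *)
From mathcomp Require Import all_boot all_order all_algebra.
From mathcomp Require Import complex.
From mathcomp Require Import all_classical all_reals all_analysis.

Set Implicit Arguments.
Unset Strict Implicit.
Unset Printing Implicit Defensive.

Import Order.TTheory GRing.Theory Num.Theory.
Import numFieldNormedType.Exports.

Local Open Scope classical_set_scope.
Local Open Scope complex_scope.
Local Open Scope ring_scope.

(* An element of L^2(T), or of a matrix-valued L^2(T), is represented by a
   function defined on all of R[i]; only its values on the unit circle
   {cis t | 0 <= t <= 2 pi} ever matter, and only up to a null set.  The Hardy
   spaces are the spaces of boundary functions: H^2 is the subspace of L^2(T)
   on which the negative Fourier coefficients vanish, and
   H^oo = H^2 \cap L^oo(T). *)

Section ScalarFunctions.
Context {R : realType}.
Implicit Types f g h : R[i] -> R[i].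

Definition cis (t : R) : R[i] := cos t +i* sin t.

Definition angles : set R := `[0, 2 * pi]%classic.

Definition ae_circle (P : R[i] -> Prop) : Prop :=
  {ae (@lebesgue_measure R), forall t : R, angles t -> P (cis t)}.

Definition measurable_circle f : Prop :=
  measurable_fun angles (fun t : R => complex.Re (f (cis t))) /\
  measurable_fun angles (fun t : R => complex.Im (f (cis t))).

Definition L2_circle f : Prop :=
  measurable_circle f /\
  (@lebesgue_measure R).-integrable angles
    (fun t => (Normc.normc (f (cis t)) ^+ 2)%:E).

Definition Linfty_circle f : Prop :=
  measurable_circle f /\ exists M : R, ae_circle (fun z => Normc.normc (f z) <= M).

Definition circle_integral f : R[i] :=
  (\int[@lebesgue_measure R]_(t in angles) complex.Re (f (cis t))) +i*
  (\int[@lebesgue_measure R]_(t in angles) complex.Im (f (cis t))).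

(* On the circle z ^ (- k) = e^{-ikt}. *)
Definition fourier_coef f (k : int) : R[i] :=
  ((2 * pi)^-1)%:C * circle_integral (fun z => f z * z ^ (- k)).

Definition H2 f : Prop :=
  L2_circle f /\ forall k : int, k < 0 -> fourier_coef f k = 0.

Definition Hinfty f : Prop := H2 f /\ Linfty_circle f.

(* A nonzero H^oo function is nonzero a.e. on the circle, so requiring the
   denominator to be nonzero a.e. is the same as requiring it to be a nonzero
   element of H^oo; it makes the division meaningful a.e. *)
Definition bounded_type f : Prop :=
  exists g h, [/\ Hinfty g, Hinfty h, ae_circle (fun z => h z != 0)
                & ae_circle (fun z => f z = g z / h z)].

Definition blaschke (alpha z : R[i]) : R[i] := (z - alpha) / (1 - (alpha^*)%C * z).

Definition blaschke_factor (theta : R[i] -> R[i]) : Prop :=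
  exists2 alpha : R[i], `|alpha| < 1 & theta = blaschke alpha.

End ScalarFunctions.

Section MatrixFunctions.
Context {R : realType}.

Definition adjmx m n (M : 'M[R[i]]_(m, n)) : 'M[R[i]]_(n, m) :=
  map_mx conjc M^T.

Definition H2_mx m n (F : R[i] -> 'M[R[i]]_(m, n)) : Prop :=
  forall i j, H2 (fun z => F z i j).

Definition Hinfty_mx m n (F : R[i] -> 'M[R[i]]_(m, n)) : Prop :=
  forall i j, Hinfty (fun z => F z i j).

Definition bounded_type_mx m n (F : R[i] -> 'M[R[i]]_(m, n)) : Prop :=
  forall i j, bounded_type (fun z => F z i j).

Definition inner_mx n m (Theta : R[i] -> 'M[R[i]]_(n, m)) : Prop :=
  Hinfty_mx Theta /\
  ae_circle (fun z => adjmx (Theta z) *m Theta z = 1%:M).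

Definition left_inner_divisor n m p (Delta : R[i] -> 'M[R[i]]_(n, m))
    (F : R[i] -> 'M[R[i]]_(n, p)) : Prop :=
  inner_mx Delta /\
  exists2 G : R[i] -> 'M[R[i]]_(m, p), H2_mx G
    & ae_circle (fun z => F z = Delta z *m G z).

(* The two equations on U force m = n. *)
Definition unitary_constant n m (Delta : R[i] -> 'M[R[i]]_(n, m)) : Prop :=
  exists U : 'M[R[i]]_(n, m),
    [/\ adjmx U *m U = 1%:M, U *m adjmx U = 1%:M
      & ae_circle (fun z => Delta z = U)].

Definition left_coprime n p q (F : R[i] -> 'M[R[i]]_(n, p))
    (G : R[i] -> 'M[R[i]]_(n, q)) : Prop :=
  forall m (Delta : R[i] -> 'M[R[i]]_(n, m)),
    left_inner_divisor Delta F -> left_inner_divisor Delta G ->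
    unitary_constant Delta.

Definition tilde_mx m n (F : R[i] -> 'M[R[i]]_(m, n)) (z : R[i]) :
    'M[R[i]]_(n, m) :=
  adjmx (F (z^*)%C).

Definition right_coprime p q n (F : R[i] -> 'M[R[i]]_(p, n))
    (G : R[i] -> 'M[R[i]]_(q, n)) : Prop :=
  left_coprime (tilde_mx F) (tilde_mx G).

(* "Phi = Theta A^* (right coprime)" *)
Definition right_coprime_factorization n
    (Phi Theta A : R[i] -> 'M[R[i]]_n) : Prop :=
  [/\ inner_mx Theta, H2_mx A,
      ae_circle (fun z => Phi z = Theta z *m adjmx (A z))
    & right_coprime Theta A].

End MatrixFunctions.

(* Main.v *)
Require Import Defs.
From HB Require Import structures.
From mathcomp Require Import all_boot all_order all_algebra.
From mathcomp Require Import complex.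
From mathcomp Require Import all_classical all_reals all_analysis.
From mathcomp Require Import measurable_realfun.
From mathcomp Require Import ring lra.

Set Implicit Arguments.
Unset Strict Implicit.
Unset Printing Implicit Defensive.

Import Order.TTheory GRing.Theory Num.Theory.
Import numFieldNormedType.Exports.

Local Open Scope classical_set_scope.
Local Open Scope complex_scope.
Local Open Scope ring_scope.

(** Composition with a Blaschke factor b of parameter alpha preserves every
    notion that occurs in a right coprime factorization, and it can be undone:
    the Blaschke factor of parameter - alpha is the inverse of b on the circle.
    Three facts give the preservation: b preserves almost-everywhere statements
    ([ae_circle_blaschke]), H^2 ([H2_blaschke]) and H^oo ([Hinfty_blaschke]).

    Coprimeness then costs nothing.  The tilde operation turns composition with
    b into composition with the Blaschke factor of the conjugate parameter
    ([tilde_mx_blaschke]), so it is enough to treat left coprimeness.  If D is a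
    common left inner divisor of F o b and G o b, then D o b^-1 is one of F and
    G, hence it is a unitary constant, and therefore so is D
    ([left_coprime_blaschke]).

    The analytic work is the change of variables on the circle.  In terms of
    angles, b is the map t |-> phi t = t + 2 atan (v t / u t), where u and v are
    the real and imaginary parts of 1 - alpha cis (- t); phi increases, commutes
    with translation by 2 pi, and its derivative at t is the Poisson kernel of
    alpha at cis t.  Lebesgue measure on the line is characterised by its values
    on intervals, so the fundamental theorem of calculus identifies it with the
    image under phi of the measure of density phi' ([line_substitution]);
    restricting to a period gives the formula on the circle.

    That the negative Fourier coefficients of f o b vanish when those of f do is
    obtained without extending f to the disk.  For k > 0 the substitution turns
    the integral of (f o b) z^k into the integral of f times
    (1 - |alpha|^2) z (z + alpha)^(k-1) / (1 + conj alpha z)^(k+1), so what is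
    needed is that the class of integrable functions with vanishing negative
    coefficients is stable under multiplication by z + alpha, which is
    immediate, and under division by 1 + conj alpha z ([H1_circle_div]). *)

(** * Measures given by a density *)

Section IntegralDensity.
Local Open Scope ereal_scope.
Context d (T : measurableType d) (R : realType).
Variables (mu : {measure set T -> \bar R}) (p : T -> R).
Hypotheses (mp : measurable_fun setT p) (p0 : forall x, (0 <= p x)%R).

Let mpE : measurable_fun setT (EFin \o p). Proof. exact/measurable_EFinP. Qed.

Import HBNNSimple.

(** Both sides agree on indicator functions by hypothesis, hence on simple
    functions, hence on their increasing limits. *)
Lemma ge0_integral_density (nu : {measure set T -> \bar R}) f :
  (forall A, measurable A -> nu A = \int[mu]_(x in A) (p x)%:E) ->
  measurable_fun setT f -> (forall x, 0 <= f x) ->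
  \int[nu]_x f x = \int[mu]_x (f x * (p x)%:E).
Proof.
move=> nuE mf f0; pose h := nnsfun_approx measurableT mf.
have hf x : EFin (h n x) @[n --> \oo] --> f x.
  by apply: cvg_nnsfun_approx.
have mh n : measurable_fun setT (EFin \o h n).
  exact/measurable_EFinP/measurable_funP.
have ndh x : {homo (fun n => (h n x)%:E) : m n / (m <= n)%N >-> m <= n}.
  by move=> m n mn; rewrite lee_fin; exact/lefP/nd_nnsfun_approx.
transitivity (limn (fun n => \int[nu]_x (h n x)%:E)).
  rewrite -monotone_convergence//=.
  - by apply: eq_integral => x _; apply/esym/cvg_lim.
  - by move=> n x _; rewrite lee_fin.
transitivity (limn (fun n => \int[mu]_x ((h n x)%:E * (p x)%:E))); last first.
  rewrite -monotone_convergence//=.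
  - apply: eq_integral => x _; apply/cvg_lim => //.
    by apply: cvgeMr; [|exact: hf].
  - by move=> n; apply: emeasurable_funM; [exact: mh|exact: mpE].
  - by move=> n x _; rewrite mule_ge0 ?lee_fin//.
  - move=> x _ m n mn; apply: lee_wpmul2r; [rewrite lee_fin; exact: p0|exact: ndh].
congr (limn _); apply/funext => n.
under eq_integral do rewrite fimfunE -fsumEFin//.
rewrite ge0_integral_fsum//; last 2 first.
  - by move=> y; exact/measurable_EFinP/measurable_funM.
  - by move=> y x _; rewrite nnfun_muleindic_ge0.
under [RHS]eq_integral.
  move=> x _.
  rewrite fimfunE -fsumEFin// ge0_mule_fsuml; last first.
    by move=> y; rewrite nnfun_muleindic_ge0.
  over.
rewrite ge0_integral_fsum//; last 2 first.
  - move=> y; apply: emeasurable_funM => //.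
    exact/measurable_EFinP/measurable_funM.
  - by move=> y x _; rewrite mule_ge0 ?nnfun_muleindic_ge0 ?lee_fin//.
apply: eq_fsbigr => r _.
rewrite integralZl_indic_nnsfun//.
have mhr : measurable (h n @^-1` [set r]) by exact: measurable_funPTI.
rewrite integral_indic// setIT.
have [r0|r0] := ltP r 0%R.
  rewrite preimage_nnfun0// measure0 mule0; apply/esym/integral0_eq => x _.
  by rewrite indic0/= mulr0 mul0e.
under [RHS]eq_integral do rewrite EFinM -muleA.
rewrite ge0_integralZl//=; last 2 first.
- by apply: emeasurable_funM => //; exact/measurable_EFinP.
- by move=> x _; rewrite mule_ge0 ?lee_fin//.
congr (_ * _); rewrite nuE//.
rewrite integral_mkcond; apply: eq_integral => x _.
rewrite patchE indicE; case: ifPn => _; by rewrite ?mul1e ?mul0e.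
Qed.

End IntegralDensity.

Section Density.
Local Open Scope ereal_scope.
Context d (T : measurableType d) (R : realType).
Variables (mu : {measure set T -> \bar R}) (p : T -> R).
Hypotheses (mp : measurable_fun setT p) (p0 : forall x, (0 <= p x)%R).

(** The two proofs are arguments so that the measure structure can be
    inferred from the term alone. *)
Definition density (_ : measurable_fun setT p) (_ : forall x, (0 <= p x)%R) :=
  fun A : set T => \int[mu]_(x in A) (p x)%:E.

Local Notation nu := (density mp p0).

Let density0 : nu set0 = 0. Proof. exact: integral_set0. Qed.

Let density_ge0 A : 0 <= nu A. Proof. by apply: integral_ge0 => x _; rewrite lee_fin. Qed.

Let density_sigma_additive : semi_sigma_additive nu.
Proof.
apply: semi_sigma_additive_nng_induced; first exact/measurable_EFinP.
by move=> x; rewrite lee_fin.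
Qed.

HB.instance Definition _ := isMeasure.Build _ _ _ nu
  density0 density_ge0 density_sigma_additive.

End Density.

(** * Change of variables on the line *)

Section LineSubstitution.
Context (R : realType) (phi dphi : R -> R).
Hypotheses (phiD : forall x : R, is_derive x (1 : R) phi (dphi x))
  (dphic : continuous dphi) (dphi_gt0 : forall x, 0 < dphi x)
  (phi_surj : forall y, exists x, phi x = y).

Let mu : {measure set (measurableTypeR R) -> \bar R} := @lebesgue_measure R.

Let phi_derivable x : derivable phi x 1.
Proof. exact: ex_derive. Qed.

Let phi_continuous : continuous phi.
Proof. by move=> x; apply/differentiable_continuous/derivable1_diffP/phi_derivable. Qed.

Let derive1_phi x : derive1 phi x = dphi x.
Proof. by rewrite derive1E derive_val. Qed.

Lemma gt0_is_derive_mono : {mono phi : x y / x < y}.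
Proof.
apply: leW_mono; apply: le_mono => x y xy.
have xI : x \in `[x, y] by rewrite in_itv/= lexx ltW.
have yI : y \in `[x, y] by rewrite in_itv/= lexx ltW.
apply: (@gtr0_derive1_lt_cc R phi x y) => //.
- by move=> z _; rewrite derive1_phi.
- by apply: continuous_subspaceT => z; exact: phi_continuous.
Qed.

Lemma measurable_is_derive : measurable_fun setT phi.
Proof. by apply: continuous_measurable_fun; exact: phi_continuous. Qed.

Lemma measurable_derivative : measurable_fun setT dphi.
Proof. exact: continuous_measurable_fun. Qed.

Let dphi_ge0 x : 0 <= dphi x. Proof. exact/ltW. Qed.

Let nu : {measure set (measurableTypeR R) -> \bar R} :=
  density mu measurable_derivative dphi_ge0.

(** Lebesgue measure is determined by its values on half-open intervals, and
    on ]phi x, phi y] the image measure is the integral of phi' over ]x, y]. *)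
Lemma lebesgue_pushforward_density A : measurable A ->
  mu A = pushforward nu (phi : measurableTypeR R -> measurableTypeR R) A.
Proof.
move=> mA; apply: lebesgue_measure_unique => //= [|_ _ [[a b]] _ <-];
  first exact: measurable_is_derive.
have [x <-] := phi_surj a; have [y <-] := phi_surj b.
rewrite /pushforward.
have -> : phi @^-1` `]phi x, phi y] = `]x, y]%classic.
  apply/seteqP; split => t /=; rewrite !in_itv/= gt0_is_derive_mono => /andP[-> /=].
    by rewrite !leNgt gt0_is_derive_mono.
  by rewrite !leNgt gt0_is_derive_mono.
rewrite lebesgue_measure_itv/= lte_fin gt0_is_derive_mono; case: ifPn => [xy|].
  apply/esym.
  transitivity (\int[mu]_(t in `[x, y]) (dphi t)%:E)%E.
    apply: integral_itv_obnd_cbnd; apply/measurable_EFinP.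
    exact: measurable_funS measurable_derivative.
  apply: continuous_FTC2 => //.
  - by apply: continuous_subspaceT => z; exact: dphic.
  - split.
    + by move=> z _; apply: phi_derivable.
    + by apply: cvg_at_right_filter; exact: phi_continuous.
    + by apply: cvg_at_left_filter; exact: phi_continuous.
rewrite -leNgt => yx; rewrite set_itv_ge ?measure0//.
by rewrite bnd_simp -leNgt.
Qed.

Lemma line_substitution (g : R -> \bar R) :
  measurable_fun setT g -> (forall x, 0 <= g x)%E ->
  (\int[mu]_x g x = \int[mu]_x (g (phi x) * (dphi x)%:E))%E.
Proof.
move=> mg g0.
transitivity (\int[pushforward nu
    (phi : measurableTypeR R -> measurableTypeR R)]_x g x)%E.
  apply: eq_measure_integral => /= [|mphi A mA _]; first exact: measurable_is_derive.
  exact: lebesgue_pushforward_density.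
rewrite ge0_integral_pushforward//=; last exact: measurable_is_derive.
rewrite preimage_setT.
apply: ge0_integral_density => //=.
- exact: measurable_derivative.
- by apply: measurableT_comp => //; exact: measurable_is_derive.
Qed.

End LineSubstitution.

(** * The action of a Blaschke factor on angles *)

Section AngleLift.
Context (R : realType) (a b : R).
Hypothesis ab1 : a ^+ 2 + b ^+ 2 < 1.

(** With alpha = a + i b, the numbers [lift_re t] and [lift_im t] are the real
    and imaginary parts of u = 1 - alpha cis (- t).  On the circle the Blaschke
    factor is cis t * u / conj u, and u has positive real part, so that twice
    the arctangent below is a continuous argument of u / conj u. *)
Definition lift_re (t : R) : R := 1 - a * cos t - b * sin t.
Definition lift_im (t : R) : R := a * sin t - b * cos t.
Definition angle_lift (t : R) : R := t + 2 * atan (lift_im t / lift_re t).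
Definition angle_speed (t : R) : R :=
  (1 - (a ^+ 2 + b ^+ 2)) / (lift_re t ^+ 2 + lift_im t ^+ 2).

(** This is |1 - u| = |alpha|; it also shows that u stays in the open right
    half-plane. *)
Lemma lift_re_im t :
  (1 - lift_re t) ^+ 2 + lift_im t ^+ 2 = a ^+ 2 + b ^+ 2.
Proof.
transitivity ((a ^+ 2 + b ^+ 2) * (cos t ^+ 2 + sin t ^+ 2)).
  by rewrite /lift_re /lift_im; ring.
by rewrite cos2Dsin2 mulr1.
Qed.

Lemma lift_re_gt0 t : 0 < lift_re t.
Proof.
rewrite ltNge; apply/negP => u0; have := lift_re_im t; have := ab1.
have := sqr_ge0 (lift_im t); nra.
Qed.

Lemma lift_norm_gt0 t : 0 < lift_re t ^+ 2 + lift_im t ^+ 2.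
Proof. by rewrite ltr_pwDl ?sqr_ge0// exprn_gt0// lift_re_gt0. Qed.

Lemma angle_speed_gt0 t : 0 < angle_speed t.
Proof. by rewrite divr_gt0 ?lift_norm_gt0// subr_gt0. Qed.

Lemma is_derive_angle_lift (t : R) :
  is_derive t (1 : R) angle_lift (angle_speed t).
Proof.
have u0 : lift_re t != 0 by rewrite gt_eqF// lift_re_gt0.
have du : is_derive t (1 : R) lift_re (lift_im t).
  rewrite /lift_re /lift_im.
  apply: is_derive_eq; rewrite /GRing.scale/=; ring.
have dv : is_derive t (1 : R) lift_im (1 - lift_re t).
  rewrite /lift_re /lift_im.
  apply: is_derive_eq; rewrite /GRing.scale/=; ring.
have dV := is_deriveV u0 du.
rewrite /angle_lift /angle_speed.
apply: is_derive_eq.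
rewrite /GRing.scale/= -(lift_re_im t).
field.
have := lift_norm_gt0 t; rewrite addrC => /gt_eqF -> /=; rewrite u0 //=.
Qed.

Lemma continuous_angle_speed : continuous angle_speed.
Proof.
have cu : continuous lift_re.
  move=> t; apply: cvgB; last by apply: cvgMr; exact: continuous_sin.
  by apply: cvgB; [exact: cvg_cst|apply: cvgMr; exact: continuous_cos].
have cv : continuous lift_im.
  move=> t; apply: cvgB; apply: cvgMr; [exact: continuous_sin|exact: continuous_cos].
move=> t; apply: cvgMr; apply: cvgV.
  by rewrite gt_eqF// lift_norm_gt0.
by apply: cvgD; apply: cvgM; [exact: cu..|exact: cv|exact: cv].
Qed.

Lemma angle_lift_bound t : t - pi < angle_lift t < t + pi.
Proof.
have := @atan_ltpi2 R (lift_im t / lift_re t).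
have := @atan_gtNpi2 R (lift_im t / lift_re t).
rewrite /angle_lift => h1 h2; apply/andP; split; lra.
Qed.

(** The intermediate value theorem applies because the lift moves points by
    less than pi. *)
Lemma angle_lift_surj y : exists t, angle_lift t = y.
Proof.
have /andP[_ h1] := angle_lift_bound (y - pi).
have /andP[h2 _] := angle_lift_bound (y + pi).
have [] := @IVT R angle_lift (y - pi) (y + pi) y.
- by have := pi_gt0 R; lra.
- apply: continuous_subspaceT => t.
  apply/differentiable_continuous/derivable1_diffP.
  by have := is_derive_angle_lift t => ?; exact: ex_derive.
- rewrite ge_min le_max; apply/andP; split; apply/orP; [left|right]; lra.
- by move=> t _ <-; exists t.
Qed.

(** Going once around the circle changes u / conj u by no net turn, because u
    stays in a half-plane; so the lift maps a period onto a period. *)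
Lemma angle_liftD2pi t : angle_lift (t + 2 * pi) = angle_lift t + 2 * pi.
Proof.
rewrite /angle_lift /lift_re /lift_im mulr_natl sinD2pi cosD2pi; ring.
Qed.

End AngleLift.

Section CisLift.
Context (R : realType).
Implicit Types (t : R) (alpha z : R[i]).

Lemma normc_sqr z : Normc.normc z ^+ 2 = complex.Re z ^+ 2 + complex.Im z ^+ 2.
Proof.
by case: z => x y /=; rewrite sqr_sqrtr// addr_ge0 ?sqr_ge0.
Qed.

Lemma normcE z : (Normc.normc z)%:C = `|z|.
Proof. by rewrite normc_def; case: z. Qed.

Lemma cisD s t : cis (s + t) = cis s * cis t.
Proof.
by apply/eqP; rewrite /cis eq_complex/= cosD sinD; apply/andP; split; apply/eqP; ring.
Qed.

Lemma cisD2pi t : cis (t + 2 * pi) = cis t.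
Proof. by rewrite /cis mulr_natl sinD2pi cosD2pi. Qed.

Lemma normc_cis t : Normc.normc (cis t) = 1.
Proof. by rewrite /= cos2Dsin2 sqrtr1. Qed.

Lemma cis_neq0 t : cis t != 0.
Proof. by rewrite -normr_eq0 -normcE normc_cis oner_eq0. Qed.

(** The half-angle parametrization of the circle. *)
Lemma cis_2atan (x : R) : cis (2 * atan x) = (1 +i* x) / (1 -i* x).
Proof.
have x2 : 0 < 1 + x ^+ 2 by rewrite ltr_pwDl ?sqr_ge0.
have c0 : cos (atan x) != 0.
  by rewrite cos_atan invr_eq0 gt_eqF// sqrtr_gt0.
have -> : 2 * atan x = atan x *+ 2 :> R by rewrite mulr_natl.
have cc : cos (atan x) ^+ 2 = (1 + x ^+ 2)^-1.
  by rewrite cos_atan exprVn sqr_sqrtr// ltW.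
have ss : sin (atan x) = x * cos (atan x).
  by have := atanK x; rewrite /tan => tx; rewrite -[X in X * _]tx divfK.
rewrite /cis cos_mulr2n sin_mulr2n ss mulrCA -expr2 cc.
apply/eqP; rewrite eq_complex/=; apply/andP; split; apply/eqP; field.
  by rewrite sqrrN gt_eqF.
by rewrite sqrrN gt_eqF.
Qed.

Lemma sqr_normc_lt1 alpha : `|alpha| < 1 -> Normc.normc alpha ^+ 2 < 1.
Proof.
rewrite -normcE -[1]/(1%:C) ltcR => h.
by rewrite -(expr1n R 2) ltr_pXn2r// nnegrE; case: (alpha) => ? ? //=; rewrite sqrtr_ge0.
Qed.

Lemma sqr_ReIm_lt1 alpha : `|alpha| < 1 ->
  complex.Re alpha ^+ 2 + complex.Im alpha ^+ 2 < 1.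
Proof. by move=> a1; rewrite -normc_sqr sqr_normc_lt1. Qed.

Lemma cis_angle_lift alpha t : `|alpha| < 1 ->
  cis (angle_lift (complex.Re alpha) (complex.Im alpha) t) =
  blaschke alpha (cis t).
Proof.
case: alpha => a b /sqr_ReIm_lt1 /= ab1.
have u0 := lift_re_gt0 ab1 t; have n0 := lift_norm_gt0 ab1 t.
rewrite /angle_lift cisD cis_2atan /blaschke.
set u := lift_re a b t; set v := lift_im a b t.
have uE : 1 - ((a +i* b)^*)%C * cis t = u -i* v.
  apply/eqP; rewrite eq_complex/= /u /v /lift_re /lift_im.
  by apply/andP; split; apply/eqP; ring.
(* The constant alpha is multiplied by 1 = cis t * cis (- t) in order to factor
   out cis t. *)
have vE : cis t - (a +i* b) = cis t * (u +i* v).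
  have -> : a +i* b = (a +i* b) * (cos t ^+ 2 + sin t ^+ 2)%:C.
    by rewrite cos2Dsin2 mulr1.
  have -> : u +i* v = 1 - (a +i* b) * (cos t -i* sin t).
    apply/eqP; rewrite eq_complex/= /u /v /lift_re /lift_im.
    by apply/andP; split; apply/eqP; ring.
  have -> : (cos t ^+ 2 + sin t ^+ 2)%:C = cis t * (cos t -i* sin t).
    by apply/eqP; rewrite eq_complex/=; apply/andP; split; apply/eqP; ring.
  ring.
have w0 : u -i* v != 0.
  rewrite eq_complex/= negb_and; apply/orP; left; exact: lt0r_neq0.
have uC : u%:C != 0 by rewrite eq_complex/= negb_and lt0r_neq0.
have -> : 1 +i* (v / u) = (u +i* v) / u%:C.
  apply: (mulIf uC); rewrite divfK//; apply/eqP; rewrite eq_complex/=.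
  by apply/andP; split; apply/eqP; field; exact: lt0r_neq0.
have -> : 1 -i* (v / u) = (u -i* v) / u%:C.
  apply: (mulIf uC); rewrite divfK//; apply/eqP; rewrite eq_complex/=.
  by apply/andP; split; apply/eqP; field; exact: lt0r_neq0.
rewrite uE vE; field; exact/andP.
Qed.

(** On the circle this is the Poisson kernel, and also the absolute value of
    the derivative of the Blaschke factor. *)
Definition poisson alpha z : R :=
  (1 - Normc.normc alpha ^+ 2) / Normc.normc (1 - (alpha^*)%C * z) ^+ 2.

Lemma angle_speedE alpha t :
  angle_speed (complex.Re alpha) (complex.Im alpha) t = poisson alpha (cis t).
Proof.
rewrite /angle_speed /poisson normc_sqr; congr (_ / _).
case: alpha => a b; rewrite normc_sqr /lift_re /lift_im/=; ring.
Qed.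

Lemma blaschke_den_neq0 alpha z : `|alpha| < 1 -> `|z| = 1 ->
  1 - (alpha^*)%C * z != 0.
Proof.
move=> a1 z1; rewrite subr_eq0; apply/eqP => e.
have : `|1 : R[i]| = `|(alpha^*)%C * z| by rewrite -e.
by rewrite normr1 normrM z1 mulr1 normcJ => e1; rewrite -e1 ltxx in a1.
Qed.

Lemma subr_mul_conjc alpha : 1 - alpha * (alpha^*)%C = (1 - Normc.normc alpha ^+ 2)%:C.
Proof. by rewrite -sqr_normc -normcE rmorphB rmorphXn/=. Qed.

Lemma subr_mul_conjc_neq0 alpha : `|alpha| < 1 -> 1 - alpha * (alpha^*)%C != 0.
Proof.
move=> a1; rewrite subr_mul_conjc eq_complex/= eqxx andbT gt_eqF//.
by rewrite subr_gt0 sqr_normc_lt1.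
Qed.

Lemma blaschke_den alpha z : 1 - (alpha^*)%C * z != 0 ->
  1 - ((- alpha)^*)%C * blaschke alpha z = (1 - alpha * (alpha^*)%C) / (1 - (alpha^*)%C * z).
Proof. by move=> h; rewrite /blaschke rmorphN; field. Qed.

Lemma blaschkeK alpha z : `|alpha| < 1 -> 1 - (alpha^*)%C * z != 0 ->
  blaschke (- alpha) (blaschke alpha z) = z.
Proof.
move=> a1 h; rewrite {1}/blaschke blaschke_den// /blaschke.
by field; rewrite h subr_mul_conjc_neq0.
Qed.

(** The chain rule for a map and its inverse. *)
Lemma poisson_blaschke alpha z : `|alpha| < 1 -> 1 - (alpha^*)%C * z != 0 ->
  poisson (- alpha) (blaschke alpha z) * poisson alpha z = 1.
Proof.
move=> a1 h; rewrite /poisson blaschke_den// subr_mul_conjc.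
rewrite normcN Normc.normcM Normc.normcV.
have n0 : Normc.normc (1 - (alpha^*)%C * z) != 0.
  by apply: contraNneq h => /Normc.eq0_normc ->.
have r0 : 0 < 1 - Normc.normc alpha ^+ 2 by rewrite subr_gt0 sqr_normc_lt1.
have -> : Normc.normc (1 - Normc.normc alpha ^+ 2)%:C = 1 - Normc.normc alpha ^+ 2.
  by rewrite /= expr0n addr0 sqrtr_sqr gtr0_norm.
by field; rewrite n0 lt0r_neq0.
Qed.

Lemma poisson_gt0 alpha z : `|alpha| < 1 -> 1 - (alpha^*)%C * z != 0 -> 0 < poisson alpha z.
Proof.
move=> a1 h; rewrite divr_gt0 ?subr_gt0 ?sqr_normc_lt1// exprn_gt0//.
by rewrite -ltcR normcE normr_gt0.
Qed.

End CisLift.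

(** * Change of variables on the circle *)

Section CircleSubstitution.
Context (R : realType).
Implicit Types (alpha z : R[i]) (x y a c : R).
Let mu : {measure set (measurableTypeR R) -> \bar R} := @lebesgue_measure R.

Section RestrictedSubstitution.
Context (phi dphi : R -> R).
Hypotheses (phiD : forall x : R, is_derive x (1 : R) phi (dphi x))
  (dphic : continuous dphi) (dphi_gt0 : forall x, 0 < dphi x)
  (phi_surj : forall y, exists x, phi x = y).

(** The line formula applied to g restricted to [phi x, phi y[. *)
Lemma itv_substitution (g : R -> \bar R) x y :
  measurable_fun setT g -> (forall x, 0 <= g x)%E ->
  (\int[mu]_(t in `[phi x, phi y[) g t =
   \int[mu]_(t in `[x, y[) (g (phi t) * (dphi t)%:E))%E.
Proof.
move=> mg g0.
rewrite integral_mkcond (line_substitution phiD dphic dphi_gt0 phi_surj).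
- rewrite [RHS]integral_mkcond; apply: eq_integral => t _.
  rewrite !patchE !mem_setE/= !in_itv/= (gt0_is_derive_mono phiD dphi_gt0).
  by rewrite !leNgt (gt0_is_derive_mono phiD dphi_gt0); case: ifP; rewrite ?mul0e.
- apply/(measurable_restrictT g) => //; exact: measurable_funTS.
- by move=> t; rewrite patchE; case: ifP.
Qed.

End RestrictedSubstitution.

Lemma itv_translation (g : R -> \bar R) x y c :
  measurable_fun setT g -> (forall x, 0 <= g x)%E ->
  (\int[mu]_(t in `[(x + c)%R, (y + c)%R[) g t = \int[mu]_(t in `[x, y[) g (t + c)%R)%E.
Proof.
move=> mg g0.
have D (t : R) : is_derive t (1 : R) (fun t => t + c) (cst 1 t).
  by apply: is_derive_eq; rewrite addr0.
rewrite (itv_substitution D)//.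
- by apply: eq_integral => t _; rewrite mule1.
- by move=> t; exact: cvg_cst.
- by move=> t; exists (t - c); rewrite subrK.
Qed.

Lemma integral_period (g : R -> \bar R) a :
  measurable_fun setT g -> (forall t, 0 <= g t)%E ->
  (forall t, g (t + 2 * pi)%R = g t) -> `|a| <= 2 * pi ->
  (\int[mu]_(t in `[a, (a + 2 * pi)%R[) g t = \int[mu]_(t in `[0%R, (2 * pi)%R[) g t)%E.
Proof.
move=> mg g0 gp.
have cut x y (z : R) : x <= y -> y <= z ->
    (\int[mu]_(t in `[x, z[) g t =
     \int[mu]_(t in `[x, y[) g t + \int[mu]_(t in `[y, z[) g t)%E.
  move=> xy yz; rewrite -ge0_integral_setU//.
  - by rewrite -itv_bndbnd_setU// bnd_simp.
  - exact: measurable_funTS.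
  - rewrite disj_set2E; apply/eqP/seteqP; split=> // t [] /=.
    by rewrite !in_itv/= => /andP[_ h1] /andP[h2 _]; have := lt_le_trans h1 h2; rewrite ltxx.
have tr x y : (\int[mu]_(t in `[(x + 2 * pi)%R, (y + 2 * pi)%R[) g t =
    \int[mu]_(t in `[x, y[) g t)%E.
  by rewrite itv_translation//; under eq_integral do rewrite gp.
(* For 0 <= c <= 2 pi the part beyond 2 pi is translated back onto [0, c[. *)
have pos c : 0 <= c -> c <= 2 * pi ->
    (\int[mu]_(t in `[c, (c + 2 * pi)%R[) g t = \int[mu]_(t in `[0%R, (2 * pi)%R[) g t)%E.
  move=> c0 c1; rewrite (cut c (2 * pi)) ?lerDr//.
  rewrite -[X in `[X, (c + 2 * pi)%R[]add0r tr addeC -cut//.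
have p0 := pi_gt0 R.
have [a0|a0] := leP 0 a; first by rewrite ger0_norm// => ?; exact: pos.
rewrite ltr0_norm// => a1.
by rewrite -tr pos//; lra.
Qed.

Lemma integral_angles (g : R -> \bar R) : measurable_fun setT g ->
  (\int[mu]_(t in angles) g t = \int[mu]_(t in `[0%R, (2 * pi)%R[) g t)%E.
Proof.
by move=> mg; rewrite -integral_itv_bndo_bndc//; exact: measurable_funTS.
Qed.

(** With phi the angle lift, phi maps [0, 2 pi[ onto [phi 0, phi 0 + 2 pi[, another
    period, over which g has the same integral. *)
Lemma periodic_substitution alpha (g : R -> \bar R) : `|alpha| < 1 ->
  measurable_fun setT g -> (forall t, 0 <= g t)%E ->
  (forall t, g (t + 2 * pi)%R = g t) ->
  (\int[mu]_(t in angles) g t =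
   \int[mu]_(t in angles)
     (g (angle_lift (complex.Re alpha) (complex.Im alpha) t) *
     (poisson alpha (cis t))%:E))%E.
Proof.
move=> a1 mg g0 gp.
have ab1 := sqr_ReIm_lt1 a1.
set phi := angle_lift (complex.Re alpha) (complex.Im alpha).
pose dphi := angle_speed (complex.Re alpha) (complex.Im alpha).
have phiD t : is_derive t (1 : R) phi (dphi t) := is_derive_angle_lift ab1 t.
have dphic : continuous dphi := continuous_angle_speed ab1.
have dphi0 t : 0 < dphi t := angle_speed_gt0 ab1 t.
have mphi : measurable_fun setT phi by exact: measurable_is_derive phiD.
rewrite !integral_angles//; last first.
  apply: emeasurable_funM; first exact: measurableT_comp.
  apply/measurable_EFinP; rewrite (_ : (fun _ => _) = dphi).
    exact: continuous_measurable_fun.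
  by apply/funext => t; rewrite -angle_speedE.
rewrite -(@integral_period g (phi 0))//.
- have -> : phi 0 + 2 * pi = phi (2 * pi) by rewrite /phi -angle_liftD2pi add0r.
  rewrite (@itv_substitution phi dphi phiD dphic dphi0 (angle_lift_surj ab1))//=.
  by apply: eq_integral => t _ /=; rewrite -angle_speedE.
- have := angle_lift_bound (complex.Re alpha) (complex.Im alpha) 0.
  rewrite -/phi => /andP[h1 h2]; rewrite ler_norml; have := pi_gt0 R.
  by move=> ?; apply/andP; split; lra.
Qed.

Lemma circle_substitution alpha (g : R[i] -> \bar R) : `|alpha| < 1 ->
  measurable_fun setT (g \o cis) -> (forall z, 0 <= g z)%E ->
  (\int[mu]_(t in angles) g (cis t) =
   \int[mu]_(t in angles) (g (blaschke alpha (cis t)) *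
     (poisson alpha (cis t))%:E))%E.
Proof.
move=> a1 mg g0; rewrite (@periodic_substitution alpha (g \o cis))//.
- by apply: eq_integral => t _ /=; rewrite cis_angle_lift.
- by move=> t; exact: g0.
- by move=> t /=; rewrite cisD2pi.
Qed.

End CircleSubstitution.

(** * Pullback along a Blaschke factor *)

Section CirclePullback.
Context (R : realType).
Implicit Types (alpha z : R[i]).
Let mu : {measure set (measurableTypeR R) -> \bar R} := @lebesgue_measure R.

Lemma measurable_angles : measurable (@angles R).
Proof. exact: measurable_itv. Qed.
Hint Resolve measurable_angles : core.

(** Measurability on the circle is assumed on [0, 2 pi] only, while lifted
    angles leave this interval; reduction modulo 2 pi is a measurable map that brings the
    angles back. *)
Definition principal_angle (t : R) : R :=
  t - 2 * pi * (Num.floor (t / (2 * pi)))%:~R.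

Let pi2_gt0 : 0 < 2 * pi :> R. Proof. by rewrite mulr_gt0// pi_gt0. Qed.

Lemma principal_angle_itv t : 0 <= principal_angle t < 2 * pi.
Proof.
rewrite /principal_angle.
have /andP[h1 h2] := floor_itv (t / (2 * pi)).
rewrite subr_ge0 ltrBlDl mulrC -ler_pdivlMr// h1/= -[X in _ + X]mul1r -mulrDl.
by rewrite -ltr_pdivrMr// -[1]/(1%:~R) -intrD.
Qed.

Lemma principal_angle_in_angles t : angles (principal_angle t).
Proof.
by have /andP[h1 /ltW h2] := principal_angle_itv t; rewrite /angles/= in_itv/= h1.
Qed.

Lemma principal_angle_id t : 0 <= t < 2 * pi -> principal_angle t = t.
Proof.
move=> /andP[t0 t1]; rewrite /principal_angle.
rewrite (@floor_def _ _ 0) ?mulr0 ?subr0// add0r.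
by rewrite divr_ge0 ?(ltW pi2_gt0)//= ltr_pdivrMr// mul1r.
Qed.

Lemma cisD2piMn (t : R) (n : nat) : cis (t + 2 * pi * n%:R) = cis t.
Proof.
elim: n => [|n IH]; first by rewrite mulr0 addr0.
by rewrite -[n.+1]addn1 [(n + 1)%:R]natrD mulrDr mulr1 addrA cisD2pi.
Qed.

Lemma cis_principal_angle t : cis (principal_angle t) = cis t.
Proof.
rewrite /principal_angle; case: Num.floor => n.
  by rewrite -[in RHS](subrK (2 * pi * n%:R) t) cisD2piMn.
by rewrite NegzE mulrNz mulrN opprK cisD2piMn.
Qed.

Lemma measurable_principal_angle : measurable_fun setT principal_angle.
Proof.
apply: measurable_funB => //; apply: measurable_funM => //.
apply: nondecreasing_measurable => // x y xy.
rewrite ler_int; apply: le_floor.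
by rewrite ler_pM2r// invr_gt0.
Qed.

Lemma measurable_line_of_angles (h : R[i] -> R) :
  measurable_fun angles (h \o cis) -> measurable_fun setT (h \o cis).
Proof.
move=> mh; rewrite (_ : _ \o _ = (h \o cis) \o principal_angle); last first.
  by apply/funext => t /=; rewrite cis_principal_angle.
apply: (measurable_comp _ _ mh) => //.
  by move=> _ [t _ <-]; exact: principal_angle_in_angles.
exact: measurable_principal_angle.
Qed.

Lemma measurable_blaschke alpha (h : R[i] -> R) : `|alpha| < 1 ->
  measurable_fun angles (h \o cis) ->
  measurable_fun setT (h \o blaschke alpha \o cis).
Proof.
move=> a1 mh.
have ab1 := sqr_ReIm_lt1 a1.
pose phi := angle_lift (complex.Re alpha) (complex.Im alpha).
rewrite (_ : _ \o _ = (h \o cis) \o phi); last first.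
  by apply/funext => t /=; rewrite cis_angle_lift.
apply: measurableT_comp; first exact: measurable_line_of_angles.
exact: measurable_is_derive (is_derive_angle_lift ab1).
Qed.

Lemma poisson_ge0 alpha z : `|alpha| < 1 -> 0 <= poisson alpha z.
Proof. by move=> a1; rewrite divr_ge0 ?sqr_ge0// subr_ge0 ltW// sqr_normc_lt1. Qed.

Lemma normr_cis (t : R) : `|cis t| = 1.
Proof. by rewrite -normcE normc_cis. Qed.

Lemma den_cis_neq0 alpha (t : R) : `|alpha| < 1 -> 1 - (alpha^*)%C * cis t != 0.
Proof. by move=> a1; apply: blaschke_den_neq0 => //; exact: normr_cis. Qed.

Lemma measurable_poisson alpha : `|alpha| < 1 ->
  measurable_fun setT (poisson alpha \o cis).
Proof.
move=> a1; rewrite (_ : _ \o _ =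
    angle_speed (complex.Re alpha) (complex.Im alpha)); last first.
  by apply/funext => t /=; rewrite angle_speedE.
apply: continuous_measurable_fun; apply: continuous_angle_speed.
exact: sqr_ReIm_lt1.
Qed.

Lemma poisson_bounded alpha : `|alpha| < 1 ->
  exists C, forall t, poisson alpha (cis t) <= C.
Proof.
move=> a1; exists ((1 - Normc.normc alpha ^+ 2) / (1 - Normc.normc alpha) ^+ 2) => t.
apply: ler_wpM2l; first by rewrite subr_ge0 ltW// sqr_normc_lt1.
have n1 : 0 < 1 - Normc.normc alpha by rewrite subr_gt0 -ltcR normcE.
have n2 : 0 < Normc.normc (1 - (alpha^*)%C * cis t).
  by rewrite -ltcR normcE normr_gt0 den_cis_neq0.
rewrite lef_pV2 ?posrE ?exprn_gt0//.
rewrite ler_pXn2r ?nnegrE ?(ltW n1) ?(ltW n2)//.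
rewrite -lecR rmorphB/= !normcE.
have := lerB_dist (1 : R[i]) ((alpha^*)%C * cis t).
by rewrite normr1 normrM normr_cis mulr1 normcJ.
Qed.

(** The weight is moved to the other side of [circle_substitution]: at
    b (cis t) the kernel of - alpha is the inverse of that of alpha at cis t. *)
Lemma ge0_integral_blaschke alpha (g : R[i] -> \bar R) : `|alpha| < 1 ->
  measurable_fun setT (g \o cis) -> (forall z, 0 <= g z)%E ->
  (\int[mu]_(t in angles) g (blaschke alpha (cis t)) =
   \int[mu]_(t in angles) (g (cis t) * (poisson (- alpha) (cis t))%:E))%E.
Proof.
move=> a1 mg g0; have a1' : `|- alpha| < 1 by rewrite normrN.
rewrite (@circle_substitution _ alpha
  (fun z => g z * (poisson (- alpha) z)%:E)%E)//.
- apply: eq_integral => t _; rewrite -muleA -EFinM poisson_blaschke ?mule1//.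
  exact: den_cis_neq0.
- apply: emeasurable_funM => //; apply/measurable_EFinP.
  exact: measurable_poisson.
- by move=> z; rewrite mule_ge0// lee_fin poisson_ge0.
Qed.

Lemma integrable_poisson alpha (h : R[i] -> R) : `|alpha| < 1 ->
  mu.-integrable angles (fun t => (h (cis t))%:E) ->
  mu.-integrable angles (fun t => (h (cis t) * poisson alpha (cis t))%:E).
Proof.
move=> a1 ih; have [C hC] := poisson_bounded a1.
have ihC : mu.-integrable angles (fun t => C%:E * (h (cis t))%:E)%E.
  exact: integrableZl.
apply: (le_integrable _ _ _ ihC) => //.
  apply/measurable_EFinP; apply: measurable_funM.
    by apply/measurable_EFinP; exact: measurable_int ih.
  by apply: measurable_funTS; exact: measurable_poisson.
move=> t _ /=; rewrite lee_fin normrM (normrM C) mulrC; apply: ler_wpM2r => //.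
by rewrite ger0_norm ?poisson_ge0//; apply: le_trans (hC t) (ler_norm _).
Qed.

(** The absolute values are integrated by [ge0_integral_blaschke], and the
    Poisson kernel is bounded on the circle. *)
Lemma integrable_blaschke alpha (h : R[i] -> R) : `|alpha| < 1 ->
  mu.-integrable angles (fun t => (h (cis t))%:E) ->
  mu.-integrable angles (fun t => (h (blaschke alpha (cis t)))%:E).
Proof.
move=> a1 ih; have a1' : `|- alpha| < 1 by rewrite normrN.
have mh : measurable_fun angles (h \o cis).
  by apply/measurable_EFinP; exact: measurable_int ih.
apply/integrableP; split.
  by apply/measurable_EFinP; apply: measurable_funTS; exact: measurable_blaschke.
have /integrableP[_] := integrable_poisson a1' ih.
apply: le_lt_trans.
rewrite (@ge0_integral_blaschke _ (fun z => `|(h z)%:E|)%E)//.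
  under [leRHS]eq_integral do rewrite EFinM abseM [X in (_ * X)%E]gee0_abs ?lee_fin ?poisson_ge0//.
  by [].
apply: measurableT_comp => //; apply/measurable_EFinP.
exact: measurable_line_of_angles.
Qed.

Lemma Rintegral_blaschke alpha (h : R[i] -> R) : `|alpha| < 1 ->
  mu.-integrable angles (fun t => (h (cis t))%:E) ->
  \int[mu]_(t in angles) h (blaschke alpha (cis t)) =
  \int[mu]_(t in angles) (h (cis t) * poisson (- alpha) (cis t)).
Proof.
move=> a1 ih; have a1' : `|- alpha| < 1 by rewrite normrN.
have mh : measurable_fun setT (h \o cis).
  apply: measurable_line_of_angles.
  by apply/measurable_EFinP; exact: measurable_int ih.
rewrite /Rintegral; congr fine; rewrite integralE [RHS]integralE; congr (_ - _)%E.
- transitivity (\int[mu]_(t in angles) (EFin \o h)^\+ (blaschke alpha (cis t)))%E.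
    by apply: eq_integral => t _; rewrite !funeposE.
  rewrite ge0_integral_blaschke//.
    apply: eq_integral => t _; rewrite !funeposE/= EFinM maxe_pMl ?mul0e//.
    by rewrite lee_fin poisson_ge0.
  have mEh : measurable_fun setT (fun t : R => (h (cis t))%:E).
    exact/measurable_EFinP.
  rewrite (_ : _ \o cis = (fun t : R => (h (cis t))%:E)^\+)%E.
    exact: measurable_funepos.
  by apply/funext => t; rewrite /= !funeposE.
- transitivity (\int[mu]_(t in angles) (EFin \o h)^\- (blaschke alpha (cis t)))%E.
    by apply: eq_integral => t _; rewrite !funenegE.
  rewrite ge0_integral_blaschke//.
    apply: eq_integral => t _; rewrite !funenegE/= -mulNr EFinM maxe_pMl ?mul0e//.
    by rewrite lee_fin poisson_ge0.
  have mEh : measurable_fun setT (fun t : R => (h (cis t))%:E).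
    exact/measurable_EFinP.
  rewrite (_ : _ \o cis = (fun t : R => (h (cis t))%:E)^\-)%E.
    exact: measurable_funeneg.
  by apply/funext => t; rewrite /= !funenegE.
Qed.

Lemma principal_angleD2pi t : principal_angle (t + 2 * pi) = principal_angle t.
Proof.
rewrite /principal_angle.
have -> : (t + 2 * pi) / (2 * pi) = t / (2 * pi) + 1.
  by rewrite mulrDl divff// lt0r_neq0.
rewrite floorDrz ?rpred1// floor1 intrD; ring.
Qed.

(** The indicator of the exceptional null set, made periodic, has integral
    zero; by the change of variables so has its composition with the angle lift
    multiplied by the Poisson kernel, which is positive. *)
Lemma ae_circle_blaschke alpha (P : R[i] -> Prop) : `|alpha| < 1 ->
  ae_circle P -> ae_circle (P \o blaschke alpha).
Proof.
move=> a1 [N [mN N0 PN]].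
pose phi := angle_lift (complex.Re alpha) (complex.Im alpha).
pose g (t : R) : \bar R := (\1_N (principal_angle t))%:E.
have mg : measurable_fun setT g.
  apply/measurable_EFinP; apply: (@measurableT_comp _ _ _ _ _ _ (\1_N : R -> R)).
    exact: measurable_indic.
  exact: measurable_principal_angle.
have g0 t : (0 <= g t)%E by rewrite lee_fin.
have gp t : g (t + 2 * pi) = g t by rewrite /g principal_angleD2pi.
have := periodic_substitution a1 mg g0 gp.
rewrite integral_angles//.
have -> : (\int[mu]_(t in `[0%R, (2 * pi)%R[) g t = 0)%E.
  transitivity (\int[mu]_(t in `[0%R, (2 * pi)%R[) (\1_N t)%:E)%E.
    by apply: eq_integral => t; rewrite inE/= in_itv/= => tI; rewrite /g principal_angle_id.
  rewrite integral_indic//; apply/eqP; rewrite eq_le measure_ge0 andbT -N0.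
  by apply: le_measure => //; rewrite ?inE//; exact: measurableI.
rewrite -/phi => /esym g_int.
have ab1 := sqr_ReIm_lt1 a1.
have mgphi : measurable_fun setT (g \o phi).
  apply: measurableT_comp => //.
  exact: measurable_is_derive (is_derive_angle_lift ab1).
have mint : measurable_fun angles
    (fun t => g (phi t) * (poisson alpha (cis t))%:E)%E.
  apply: measurable_funTS; apply: emeasurable_funM => //.
  by apply/measurable_EFinP; exact: measurable_poisson.
have [+ _] := @ae_eq_integral_abs _ (measurableTypeR R) R mu _ measurable_angles _ mint.
have -> : (\int[mu]_(x in angles) `|g (phi x) * (poisson alpha (cis x))%:E| = 0)%E.
  rewrite -g_int; apply: eq_integral => t _.
  by rewrite gee0_abs// mule_ge0// lee_fin poisson_ge0.
move=> /(_ erefl); apply: filterS => t + tI => /(_ tI) /=.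
rewrite /g -EFinM => /eqP; rewrite eqe mulf_eq0.
have := poisson_gt0 a1 (den_cis_neq0 t a1) => /gt_eqF ->; rewrite orbF.
rewrite indicE pnatr_eq0 eqb0 => tN.
rewrite -cis_angle_lift// -cis_principal_angle.
have := @contra_notP _ _ (PN (principal_angle (phi t))).
apply; last exact: principal_angle_in_angles.
by move=> /mem_set; exact/negP.
Qed.

End CirclePullback.

(** * Integrable functions on the circle *)

Section CircleIntegral.
Context (R : realType).
Implicit Types (alpha z c : R[i]) (f g : R[i] -> R[i]).
Let mu : {measure set (measurableTypeR R) -> \bar R} := @lebesgue_measure R.
Let mA : measurable (@angles R : set (measurableTypeR R)).
Proof. exact: measurable_angles. Qed.
Hint Resolve measurable_angles mA : core.
Local Notation Re := complex.Re.
Local Notation Im := complex.Im.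
Local Notation normc := Normc.normc.

Lemma ReD z c : Re (z + c) = Re z + Re c. Proof. by case: z; case: c. Qed.
Lemma ImD z c : Im (z + c) = Im z + Im c. Proof. by case: z; case: c. Qed.
Lemma ReM z c : Re (z * c) = Re z * Re c - Im z * Im c.
Proof. by case: z; case: c. Qed.
Lemma ImM z c : Im (z * c) = Re z * Im c + Im z * Re c.
Proof. by case: z; case: c. Qed.

Lemma normc_ge0 z : 0 <= normc z. Proof. by case: z => x y; exact: sqrtr_ge0. Qed.

Lemma normr_Re_le z : `|Re z| <= normc z.
Proof.
rewrite -ler_sqr ?nnegrE ?normc_ge0// normc_sqr real_normK ?num_real//.
by rewrite lerDl sqr_ge0.
Qed.

Lemma normr_Im_le z : `|Im z| <= normc z.
Proof.
rewrite -ler_sqr ?nnegrE ?normc_ge0// normc_sqr real_normK ?num_real//.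
by rewrite lerDr sqr_ge0.
Qed.

Lemma normc_le_ReIm z : normc z <= `|Re z| + `|Im z|.
Proof.
rewrite -ler_sqr ?nnegrE ?normc_ge0 ?addr_ge0// normc_sqr sqrrD.
by rewrite !real_normK ?num_real// lerD2r lerDl mulrn_wge0// mulr_ge0.
Qed.

Lemma measurable_circleD f g : measurable_circle f -> measurable_circle g ->
  measurable_circle (fun z => f z + g z).
Proof.
move=> [f1 f2] [g1 g2]; split.
- by under eq_fun do rewrite ReD; exact: measurable_funD.
- by under eq_fun do rewrite ImD; exact: measurable_funD.
Qed.

Lemma measurable_circleM f g : measurable_circle f -> measurable_circle g ->
  measurable_circle (fun z => f z * g z).
Proof.
move=> [f1 f2] [g1 g2]; split.
- under eq_fun do rewrite ReM.
  by apply: measurable_funB; exact: measurable_funM.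
- under eq_fun do rewrite ImM.
  by apply: measurable_funD; exact: measurable_funM.
Qed.

Lemma measurable_circle_cst c : measurable_circle (fun=> c).
Proof. by split; exact: measurable_cst. Qed.

Lemma measurable_circle_id : measurable_circle (@id R[i]).
Proof.
split; apply: measurable_funTS; apply: continuous_measurable_fun.
- exact: continuous_cos.
- exact: continuous_sin.
Qed.

Lemma measurable_circle_conj f :
  measurable_circle f -> measurable_circle (fun z => ((f z)^*)%C).
Proof.
move=> [f1 f2]; split.
- by rewrite (_ : (fun _ => _) = (fun t => Re (f (cis t))))//; apply/funext => t; case: (f _).
- rewrite (_ : (fun _ => _) = (fun t => - Im (f (cis t)))).
    exact: measurable_funN.
  by apply/funext => t; case: (f _).
Qed.

Lemma measurable_circle_real (h : R[i] -> R) :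
  measurable_fun angles (h \o cis) -> measurable_circle (fun z => (h z)%:C).
Proof. by move=> mh; split=> //=; exact: measurable_cst. Qed.

Definition L1_circle f :=
  mu.-integrable angles (fun t => (Re (f (cis t)))%:E) /\
  mu.-integrable angles (fun t => (Im (f (cis t)))%:E).

Lemma eq_L1_circle f g : (forall t, f (cis t) = g (cis t)) ->
  L1_circle f -> L1_circle g.
Proof.
by move=> fg [f1 f2]; split; under eq_fun do rewrite -fg.
Qed.

Lemma eq_circle_integral f g : (forall t, f (cis t) = g (cis t)) ->
  circle_integral f = circle_integral g.
Proof. by move=> fg; congr Complex; apply: eq_Rintegral => t _; rewrite fg. Qed.

Lemma L1_circleD f g : L1_circle f -> L1_circle g -> L1_circle (fun z => f z + g z).
Proof.
move=> [f1 f2] [g1 g2]; split.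
- by under eq_fun do rewrite ReD EFinD; exact: integrableD.
- by under eq_fun do rewrite ImD EFinD; exact: integrableD.
Qed.

Lemma circle_integralD f g : L1_circle f -> L1_circle g ->
  circle_integral (fun z => f z + g z) = circle_integral f + circle_integral g.
Proof.
move=> [f1 f2] [g1 g2]; apply/eqP; rewrite eq_complex/=; apply/andP; split; apply/eqP.
- by under eq_Rintegral do rewrite ReD; rewrite RintegralD.
- by under eq_Rintegral do rewrite ImD; rewrite RintegralD.
Qed.

Lemma circle_integralZ c f : L1_circle f ->
  circle_integral (fun z => c * f z) = c * circle_integral f.
Proof.
move=> [f1 f2]; apply/eqP; rewrite eq_complex ReM ImM/=.
have iZ (r : R) (h : R -> R) : mu.-integrable angles (EFin \o h) ->
    mu.-integrable angles (fun t => (r * h t)%:E).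
  by move=> ih; under eq_fun do rewrite EFinM; exact: integrableZl.
apply/andP; split; apply/eqP.
- under eq_Rintegral do rewrite ReM.
  by rewrite RintegralB ?RintegralZl//; exact: iZ.
- under eq_Rintegral do rewrite ImM.
  by rewrite RintegralD ?RintegralZl//; exact: iZ.
Qed.

Lemma integrable_bounded_mul (F G : R -> R) M :
  mu.-integrable angles (fun t => (F t)%:E) -> measurable_fun angles G ->
  (forall t, `|G t| <= M) -> mu.-integrable angles (fun t => (F t * G t)%:E).
Proof.
move=> iF mG GM.
have iFM : mu.-integrable angles (fun t => M%:E * (F t)%:E)%E by exact: integrableZl.
apply: (le_integrable _ _ _ iFM) => //.
  apply/measurable_EFinP; apply: measurable_funM => //.
  by apply/measurable_EFinP; exact: measurable_int iF.
move=> t _ /=; rewrite lee_fin !normrM mulrC; apply: ler_wpM2r => //.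
exact: le_trans (GM t) (ler_norm _).
Qed.

Lemma L1_circleM f g M : L1_circle f -> measurable_circle g ->
  (forall t, normc (g (cis t)) <= M) -> L1_circle (fun z => f z * g z).
Proof.
move=> [f1 f2] [g1 g2] gM.
have reM t : `|Re (g (cis t))| <= M := le_trans (normr_Re_le _) (gM t).
have imM t : `|Im (g (cis t))| <= M := le_trans (normr_Im_le _) (gM t).
split.
- under eq_fun do rewrite ReM EFinB.
  by apply: integrableB => //; apply: integrable_bounded_mul => //.
- under eq_fun do rewrite ImM EFinD.
  by apply: integrableD => //; apply: integrable_bounded_mul => //.
Qed.

Lemma L1_circleZ c f : L1_circle f -> L1_circle (fun z => c * f z).
Proof.
move=> f1; apply: (@eq_L1_circle (fun z => f z * c)); first by move=> t; rewrite mulrC.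
exact: L1_circleM (measurable_circle_cst c) (fun=> lexx _).
Qed.

Lemma normcX z n : normc (z ^+ n) = normc z ^+ n.
Proof.
by apply: complexI; rewrite normcE normrX rmorphXn/= normcE.
Qed.

Lemma normc_cisX (t : R) n : normc (cis t ^+ n) = 1.
Proof. by rewrite normcX normc_cis expr1n. Qed.

Lemma measurable_circleX f n : measurable_circle f ->
  measurable_circle (fun z => f z ^+ n).
Proof.
move=> mf; elim: n => [|n IH]; first exact: measurable_circle_cst.
by under eq_fun do rewrite exprS; exact: measurable_circleM.
Qed.

Lemma L1_circleX f n : L1_circle f -> L1_circle (fun z => f z * z ^+ n).
Proof.
move=> f1; apply: L1_circleM f1 (measurable_circleX n measurable_circle_id) _ => t.
by rewrite normc_cisX.
Qed.

(** Since |z| <= 1 + |z|^2 and the circle has finite measure. *)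
Lemma L2_L1_circle f : L2_circle f -> L1_circle f.
Proof.
move=> [[m1 m2] i2].
have i1 : mu.-integrable angles (fun t => (1 + normc (f (cis t)) ^+ 2)%:E).
  under eq_fun do rewrite EFinD; apply: integrableD => //.
  apply/integrableP; split; first exact: measurable_cst.
  by rewrite integral_cst//= lebesgue_measure_itv; case: ifP => _; rewrite ?mule0 ?normr1 ?mul1e ?ltry.
have h z : normc z <= 1 + normc z ^+ 2.
  by have := normc_ge0 z; have := sqr_ge0 (normc z - 1); nra.
split; apply: (le_integrable _ _ _ i1) => //; try exact/measurable_EFinP.
- move=> t _ /=; rewrite lee_fin (le_trans (normr_Re_le _))//.
  exact: le_trans (h _) (ler_norm _).
- move=> t _ /=; rewrite lee_fin (le_trans (normr_Im_le _))//.
  exact: le_trans (h _) (ler_norm _).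
Qed.

(** The factor z^n has modulus one, so one multiple of the L^1 norm of
    f bounds all the integrals. *)
Lemma circle_integral_bounded f : L1_circle f ->
  exists C, forall n, normc (circle_integral (fun z => f z * z ^+ n)) <= C.
Proof.
move=> f1; have [i1 i2] := f1.
have iG : mu.-integrable angles
    (fun t => (`|Re (f (cis t))| + `|Im (f (cis t))|)%:E).
  by under eq_fun do rewrite EFinD; apply: integrableD => //;
    [exact: integrable_norm i1|exact: integrable_norm i2].
pose C := \int[mu]_(t in angles) (`|Re (f (cis t))| + `|Im (f (cis t))|).
have bd t n : normc (f (cis t) * cis t ^+ n) <= `|Re (f (cis t))| + `|Im (f (cis t))|.
  by rewrite Normc.normcM normc_cisX mulr1 normc_le_ReIm.
exists (C + C) => n; have [j1 j2] := L1_circleX n f1.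
apply: le_trans (normc_le_ReIm _) _ => /=; apply: lerD.
- apply: le_trans (le_normr_Rintegral _ j1) _ => //.
  apply: le_Rintegral => //; first exact: integrable_norm j1.
  by move=> t _; exact: le_trans (normr_Re_le _) (bd t n).
- apply: le_trans (le_normr_Rintegral _ j2) _ => //.
  apply: le_Rintegral => //; first exact: integrable_norm j2.
  by move=> t _; exact: le_trans (normr_Im_le _) (bd t n).
Qed.

Lemma L1_circle_blaschke alpha f : `|alpha| < 1 -> L1_circle f ->
  L1_circle (f \o blaschke alpha).
Proof.
move=> a1 [f1 f2]; split.
- exact: (@integrable_blaschke _ alpha (fun z => Re (f z))).
- exact: (@integrable_blaschke _ alpha (fun z => Im (f z))).
Qed.

Lemma circle_integral_blaschke alpha f : `|alpha| < 1 -> L1_circle f ->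
  circle_integral (f \o blaschke alpha) =
  circle_integral (fun z => f z * (poisson (- alpha) z)%:C).
Proof.
move=> a1 [f1 f2]; congr Complex.
- rewrite (@Rintegral_blaschke _ alpha (fun z => Re (f z)))//.
  by apply: eq_Rintegral => t _; rewrite ReM/= mulr0 subr0.
- rewrite (@Rintegral_blaschke _ alpha (fun z => Im (f z)))//.
  by apply: eq_Rintegral => t _; rewrite ImM/= mulr0 add0r.
Qed.

End CircleIntegral.

(** * Functions with vanishing negative Fourier coefficients *)

Section AnalyticClass.
Context (R : realType).
Implicit Types (alpha z c : R[i]) (f g : R[i] -> R[i]).
Local Notation normc := Normc.normc.

(** These are the boundary functions of the Hardy space H^1: the exponent m + 1
    stands for the Fourier index - (m + 1). *)
Definition H1_circle f : Prop :=
  L1_circle f /\ forall m, circle_integral (fun z => f z * z ^+ m.+1) = 0.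

Lemma fourier_coef_lt0P f :
  (forall k : int, k < 0 -> fourier_coef f k = 0) <->
  (forall m, circle_integral (fun z => f z * z ^+ m.+1) = 0).
Proof.
have pi0 : ((2 * pi)^-1)%:C != 0 :> R[i].
  by rewrite eq_complex/= eqxx andbT invr_eq0 gt_eqF// mulr_gt0// pi_gt0.
have E m : fourier_coef f (Negz m) =
    ((2 * pi)^-1)%:C * circle_integral (fun z => f z * z ^+ m.+1).
  by rewrite /fourier_coef NegzE opprK.
split=> h m.
  have /eqP := h (Negz m) erefl.
  by rewrite E mulf_eq0 (negbTE pi0)/= => /eqP.
by case: m => // m _; rewrite E h mulr0.
Qed.

Lemma H2_H1_circle f : H2 f -> H1_circle f.
Proof. by move=> [f2 /fourier_coef_lt0P f0]; split=> //; exact: L2_L1_circle. Qed.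

Lemma eq_H1_circle f g : (forall t, f (cis t) = g (cis t)) ->
  H1_circle f -> H1_circle g.
Proof.
move=> fg [f1 f0]; split=> [|m]; first exact: eq_L1_circle f1.
by rewrite -(f0 m); apply: eq_circle_integral => t; rewrite fg.
Qed.

Lemma H1_circle_mulXDC f c : H1_circle f -> H1_circle (fun z => f z * (z + c)).
Proof.
move=> [f1 f0]; have fX n := L1_circleX n f1.
have E n z : f z * (z + c) * z ^+ n = f z * z ^+ n.+1 + c * (f z * z ^+ n).
  by rewrite exprS; ring.
split.
  apply: (@eq_L1_circle _ (fun z => f z * z ^+ 1 + c * (f z * z ^+ 0))).
    by move=> t; rewrite -E expr0 mulr1.
  by apply: L1_circleD => //; exact: L1_circleZ.
move=> m; rewrite (@eq_circle_integral _ _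
  (fun z => f z * z ^+ m.+2 + c * (f z * z ^+ m.+1))); last by move=> t; rewrite E.
rewrite circle_integralD//; last exact: L1_circleZ.
by rewrite circle_integralZ// !f0 mulr0 addr0.
Qed.

Lemma H1_circle_mulXDC_exp f c n :
  H1_circle f -> H1_circle (fun z => f z * (z + c) ^+ n).
Proof.
move=> f1; elim: n => [|n IH].
  by apply: eq_H1_circle f1 => t; rewrite expr0 mulr1.
apply: eq_H1_circle (H1_circle_mulXDC c IH) => t.
by rewrite exprSr mulrA.
Qed.

Lemma blaschke_den_inv alpha z : `|alpha| < 1 -> (1 - (alpha^*)%C * z)^-1 =
  (poisson alpha z / (1 - normc alpha ^+ 2))%:C * ((1 - (alpha^*)%C * z)^*)%C.
Proof.
move=> a1; rewrite invc_norm -normcE -rmorphXn -fmorphV/=; congr (_%:C * _).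
by rewrite /poisson mulrAC divff ?mul1r// lt0r_neq0// subr_gt0 sqr_normc_lt1.
Qed.

Lemma measurable_circle_blaschke_den alpha : `|alpha| < 1 ->
  measurable_circle (fun z => (1 - (alpha^*)%C * z)^-1).
Proof.
move=> a1; under eq_fun do rewrite blaschke_den_inv//.
apply: measurable_circleM.
  apply: measurable_circle_real; apply: measurable_funM => //.
  by apply: measurable_funTS; exact: measurable_poisson.
apply: measurable_circle_conj; under eq_fun do rewrite -mulNr.
apply: measurable_circleD; first exact: measurable_circle_cst.
by apply: measurable_circleM; [exact: measurable_circle_cst|exact: measurable_circle_id].
Qed.

Lemma blaschke_den_inv_bounded alpha : `|alpha| < 1 ->
  exists M, forall t : R, normc (1 - (alpha^*)%C * cis t)^-1 <= M.
Proof.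
move=> a1; have [C hC] := poisson_bounded a1.
have r0 : 0 < 1 - normc alpha ^+ 2 by rewrite subr_gt0 sqr_normc_lt1.
exists (1 + C / (1 - normc alpha ^+ 2)) => t.
set y := normc _.
have y2 : y ^+ 2 = poisson alpha (cis t) / (1 - normc alpha ^+ 2).
  by rewrite /y Normc.normcV exprVn /poisson mulrAC divff ?mul1r// lt0r_neq0.
have y0 : 0 <= y by exact: normc_ge0.
have : y ^+ 2 <= C / (1 - normc alpha ^+ 2) by rewrite y2 ler_pM2r ?invr_gt0.
by have := sqr_ge0 (y - 1); nra.
Qed.

(** The supremum S of such a sequence satisfies S <= q S, hence S <= 0. *)
Lemma bounded_backward_geometric_eq0 (q C : R) (c : nat -> R) : q < 1 ->
  (forall n, 0 <= c n) -> 0 <= q ->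
  (forall n, c n <= C) -> (forall n, c n = q * c n.+1) -> forall n, c n = 0.
Proof.
move=> q1 c0 q0 cC cq.
have supc : has_sup (range c).
  by split; [exists (c 0%N); exists 0%N|exists C => _ [n _ <-]].
have cS n : c n <= sup (range c) by apply: sup_upper_bound => //; exists n.
have Sq : sup (range c) <= q * sup (range c).
  apply: ge_sup; first by case: supc.
  by move=> _ [n _ <-]; rewrite cq ler_wpM2l.
have S0 : sup (range c) <= 0 by nra.
by move=> n; apply/eqP; rewrite eq_le c0 (le_trans (cS n)).
Qed.

(** Put u = f / (1 - conj alpha z) and let c_n be the integral of u z^(n+1).
    Multiplying u by its denominator gives c_n - conj alpha c_(n+1) = 0 for
    every n.  The c_n are bounded and |alpha| < 1, so they all vanish. *)
Lemma H1_circle_div alpha f : `|alpha| < 1 -> H1_circle f ->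
  H1_circle (fun z => f z / (1 - (alpha^*)%C * z)).
Proof.
move=> a1 [f1 f0]; have [M hM] := blaschke_den_inv_bounded a1.
have u1 : L1_circle (fun z => f z / (1 - (alpha^*)%C * z)).
  exact: L1_circleM f1 (measurable_circle_blaschke_den a1) hM.
split=> // m; set u := fun z => _ in u1; rewrite -/(u _).
have uX n := L1_circleX n u1.
have cE n : circle_integral (fun z => u z * z ^+ n.+1) =
    (alpha^*)%C * circle_integral (fun z => u z * z ^+ n.+2).
  apply/eqP; rewrite -subr_eq0 -mulNr -circle_integralZ// -circle_integralD//.
    rewrite -(f0 n); apply/eqP/eq_circle_integral => t.
    by rewrite /u [cis t ^+ n.+2]exprS; field; exact: den_cis_neq0.
  exact: L1_circleZ.
have [C hC] := circle_integral_bounded u1.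
have a0 : normc alpha < 1 by rewrite -ltcR normcE.
have := @bounded_backward_geometric_eq0 _ C
  (fun n => normc (circle_integral (fun z => u z * z ^+ n.+1))) a0.
move=> h; apply: Normc.eq0_normc; apply: h => [n||n|n]; rewrite ?normc_ge0//.
rewrite cE Normc.normcM; congr (_ * _).
by apply: complexI; rewrite !normcE normcJ.
Qed.

Lemma H1_circle_div_exp alpha f n : `|alpha| < 1 -> H1_circle f ->
  H1_circle (fun z => f z / (1 - (alpha^*)%C * z) ^+ n).
Proof.
move=> a1 f1; elim: n => [|n IH].
  by apply: eq_H1_circle f1 => t; rewrite expr0 divr1.
apply: eq_H1_circle (H1_circle_div a1 IH) => t.
by rewrite exprS invfM mulrA mulrAC.
Qed.

Lemma conjc_cis (t : R) : ((cis t)^*)%C = (cis t)^-1.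
Proof. by rewrite invc_norm normr_cis expr1n invr1 mul1r. Qed.

Lemma cis_addr_neq0 alpha (t : R) : `|alpha| < 1 -> cis t + alpha != 0.
Proof.
move=> a1; rewrite addr_eq0; apply/eqP => e.
by have := normr_cis t; rewrite e normrN => e1; rewrite e1 ltxx in a1.
Qed.

(** On the circle conj z = 1 / z, which makes the Poisson kernel a rational
    function of z. *)
Lemma poisson_cis alpha (t : R) : `|alpha| < 1 ->
  (poisson (- alpha) (cis t))%:C = (1 - normc alpha ^+ 2)%:C * cis t /
    ((1 - ((- alpha)^*)%C * cis t) * (cis t + alpha)).
Proof.
move=> a1; have a1' : `|- alpha| < 1 by rewrite normrN.
have w0 : 1 - ((- alpha)^*)%C * cis t != 0 by exact: den_cis_neq0.
have wE : ((1 - ((- alpha)^*)%C * cis t)^*)%C = (cis t + alpha) / cis t.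
  rewrite [RHS]mulrDl divff ?cis_neq0// -conjc_cis.
  by rewrite rmorphB rmorph1 rmorphM/= conjcK mulNr opprK.
have za := cis_addr_neq0 t a1.
rewrite /poisson normcN rmorphM/= fmorphV rmorphXn/= normcE sqr_normc wE.
by move: w0; set w := 1 - _ => w0; field; rewrite w0 za cis_neq0.
Qed.

Lemma measurable_circle_blaschke alpha : `|alpha| < 1 ->
  measurable_circle (blaschke alpha).
Proof.
move=> a1; apply: measurable_circleM; last exact: measurable_circle_blaschke_den.
by apply: measurable_circleD; [exact: measurable_circle_id|exact: measurable_circle_cst].
Qed.

(** On the circle z = b^-1 (b z), so (f o b) z^(m+1) is the pullback of
    g = f (b^-1)^(m+1).  Its integral is that of g times the kernel of - alpha,
    and the rational function obtained has a factor z left over in its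
    numerator: this is what brings in the coefficient of index -1 of
    f (z + alpha)^m / (1 + conj alpha z)^(m+2). *)
Lemma H1_circle_blaschke alpha f : `|alpha| < 1 -> H1_circle f ->
  H1_circle (f \o blaschke alpha).
Proof.
move=> a1 f1; have a1' : `|- alpha| < 1 by rewrite normrN.
have [fL _] := f1.
split=> [|m]; first exact: L1_circle_blaschke.
pose g z := f z * blaschke (- alpha) z ^+ m.+1.
have gL : L1_circle g.
  apply: (L1_circleM (M := 1)) fL _ _.
    by apply: measurable_circleX; exact: measurable_circle_blaschke.
  by move=> t; rewrite normcX -cis_angle_lift// normc_cis expr1n.
transitivity (circle_integral (g \o blaschke alpha)).
  apply: eq_circle_integral => t; rewrite /g/= blaschkeK//.
  exact: den_cis_neq0.
rewrite circle_integral_blaschke//.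
have [_ /(_ 0%N) h0] := H1_circle_div_exp m.+2 a1' (H1_circle_mulXDC_exp alpha m f1).
rewrite -[RHS](mulr0 (1 - normc alpha ^+ 2)%:C) -h0 -circle_integralZ; last first.
  by apply: L1_circleX; case: (H1_circle_div_exp m.+2 a1' (H1_circle_mulXDC_exp alpha m f1)).
apply: eq_circle_integral => t.
have w0 : 1 - ((- alpha)^*)%C * cis t != 0 by exact: den_cis_neq0.
have za := cis_addr_neq0 t a1.
rewrite poisson_cis// /g /blaschke opprK expr1 expr_div_n [(cis t + alpha) ^+ m.+1]exprS.
move: w0; set w := 1 - _ => w0.
by rewrite [_ ^+ m.+2]exprS; field; rewrite w0 za/= expf_neq0.
Qed.

End AnalyticClass.

(** * Composition of matrix functions with a Blaschke factor *)

Section Composition.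
Context (R : realType).
Implicit Types (alpha : R[i]) (f g : R[i] -> R[i]).

Lemma H2_blaschke alpha f : `|alpha| < 1 -> H2 f -> H2 (f \o blaschke alpha).
Proof.
move=> a1 f2; have [[[m1 m2] i2] _] := f2; split; last first.
  apply/fourier_coef_lt0P.
  by have [] := H1_circle_blaschke a1 (H2_H1_circle f2).
split; last first.
  exact: (@integrable_blaschke _ alpha (fun z => Normc.normc (f z) ^+ 2)).
split; apply: measurable_funTS.
- exact: (@measurable_blaschke _ alpha (fun z => complex.Re (f z))).
- exact: (@measurable_blaschke _ alpha (fun z => complex.Im (f z))).
Qed.

Lemma Hinfty_blaschke alpha f : `|alpha| < 1 -> Hinfty f ->
  Hinfty (f \o blaschke alpha).
Proof.
move=> a1 [f2 [_ [M fM]]]; have [[mf _] _] := H2_blaschke a1 f2.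
split; first exact: H2_blaschke.
by split=> //; exists M; exact: ae_circle_blaschke a1 fM.
Qed.

Lemma ae_circle_imply (P Q : R[i] -> Prop) :
  (forall t : R, P (cis t) -> Q (cis t)) -> ae_circle P -> ae_circle Q.
Proof. by move=> PQ; apply: (@filterS _ _ (ae_filter_ringOfSetsType lebesgue_measure)) => t Pt /Pt; exact: PQ. Qed.

Lemma blaschkeNK alpha (t : R) : `|alpha| < 1 ->
  blaschke alpha (blaschke (- alpha) (cis t)) = cis t.
Proof.
move=> a1; rewrite -{1}[alpha]opprK blaschkeK ?normrN//.
by apply: den_cis_neq0; rewrite normrN.
Qed.

Lemma H2_mx_blaschke alpha m n (F : R[i] -> 'M[R[i]]_(m, n)) : `|alpha| < 1 ->
  H2_mx F -> H2_mx (F \o blaschke alpha).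
Proof. by move=> a1 F2 i j; exact: (H2_blaschke a1 (F2 i j)). Qed.

Lemma inner_mx_blaschke alpha m n (F : R[i] -> 'M[R[i]]_(m, n)) : `|alpha| < 1 ->
  inner_mx F -> inner_mx (F \o blaschke alpha).
Proof.
move=> a1 [Foo Fi]; split; last exact: ae_circle_blaschke a1 Fi.
by move=> i j; exact: (Hinfty_blaschke a1 (Foo i j)).
Qed.

Lemma tilde_mx_blaschke alpha m n (F : R[i] -> 'M[R[i]]_(m, n)) :
  tilde_mx (F \o blaschke alpha) = tilde_mx F \o blaschke (alpha^*)%C.
Proof.
apply/funext => z; rewrite /tilde_mx/=; congr (adjmx (F _)).
by rewrite /blaschke rmorphM fmorphV !rmorphB rmorphM rmorph1/= !conjcK.
Qed.

(** If F o b = D G then F = (D o b^-1) (G o b^-1). *)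
Lemma left_inner_divisor_blaschkeN alpha n m p
    (D : R[i] -> 'M[R[i]]_(n, m)) (F : R[i] -> 'M[R[i]]_(n, p)) : `|alpha| < 1 ->
  left_inner_divisor D (F \o blaschke alpha) ->
  left_inner_divisor (D \o blaschke (- alpha)) F.
Proof.
move=> a1 [Di [G G2 FDG]]; have a1' : `|- alpha| < 1 by rewrite normrN.
split; first exact: inner_mx_blaschke.
exists (G \o blaschke (- alpha)); first exact: H2_mx_blaschke.
apply: ae_circle_imply (ae_circle_blaschke a1' FDG) => t /=.
by rewrite blaschkeNK.
Qed.

Lemma unitary_constant_blaschkeN alpha n m (D : R[i] -> 'M[R[i]]_(n, m)) :
  `|alpha| < 1 -> unitary_constant (D \o blaschke (- alpha)) -> unitary_constant D.
Proof.
move=> a1 [U [U1 U2 DU]]; exists U; split=> //.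
apply: ae_circle_imply (ae_circle_blaschke a1 DU) => t /=.
by rewrite blaschkeK//; exact: den_cis_neq0.
Qed.

Lemma left_coprime_blaschke alpha n p q (F : R[i] -> 'M[R[i]]_(n, p))
    (G : R[i] -> 'M[R[i]]_(n, q)) : `|alpha| < 1 ->
  left_coprime F G -> left_coprime (F \o blaschke alpha) (G \o blaschke alpha).
Proof.
move=> a1 FG m D DF DG; apply: (unitary_constant_blaschkeN a1).
by apply: FG; exact: left_inner_divisor_blaschkeN.
Qed.

Lemma right_coprime_blaschke alpha p q n (F : R[i] -> 'M[R[i]]_(p, n))
    (G : R[i] -> 'M[R[i]]_(q, n)) : `|alpha| < 1 ->
  right_coprime F G -> right_coprime (F \o blaschke alpha) (G \o blaschke alpha).
Proof.
move=> a1 FG; rewrite /right_coprime !tilde_mx_blaschke.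
by apply: left_coprime_blaschke; rewrite ?normcJ.
Qed.

End Composition.

Theorem theorem4p40 (R : realType) (n : nat)
    (Phi Theta A : R[i] -> 'M[R[i]]_n)
    (hPhi : H2_mx Phi)
    (hPhi_adj : bounded_type_mx (fun z => adjmx (Phi z)))
    (hfact : right_coprime_factorization Phi Theta A)
    (theta : R[i] -> R[i]) (htheta : blaschke_factor theta) :
  right_coprime_factorization
    (Phi \o theta) (Theta \o theta) (A \o theta).
Proof.
have [alpha a1 ->] := htheta; have [iTheta hA fact co] := hfact.
split.
- exact: inner_mx_blaschke.
- exact: H2_mx_blaschke.
- exact: ae_circle_blaschke a1 fact.
- exact: right_coprime_blaschke.
Qed.
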